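(* The Bass conjecture holds for all groups if and only if it holds for all binate groups.
   Context: Binate groups: write $[u,v]=uvu^{-1}v^{-1}$. A nontrivial group $G$ is called binate if for every finitely generated subgroup $H$ of $G$ there exist a homomorphism $\varphi_H:H\rightarrow G$ and an element $u_H\in G$ such that $h=[u_H,\varphi_H(h)]$ for all $h\in H$. Bass conjecture: for a group $G$ with integral group ring $\mathbb{Z}G$, let $[\mathbb{Z}G,\mathbb{Z}G]$ be the additive subgroup of $\mathbb{Z}G$ generated by the elements $gh-hg$ ($g,h\in G$), and let $HH_0(\mathbb{Z}G)=\mathbb{Z}G/[\mathbb{Z}G,\mathbb{Z}G]$, identified with $\bigoplus_{[s]\in[G]}\mathbb{Z}\cdot[s]$, where $[G]$ is the set of conjugacy classes $[s]$ of elements $s$ of $G$. The Hattori-Stallings trace of $M=\sum_{g\in G}m_g g\in\mathbb{Z}G$ is $\mathrm{HS}(M)=M+[\mathbb{Z}G,\mathbb{Z}G]=\sum_{[s]\in[G]}\epsilon_s(M)[s]$, where $\epsilon_s(M)=\sum_{g\in[s]}m_g$. An element of $K_0(\mathbb{Z}G)$ is represented by a difference of finitely generated projective $\mathbb{Z}G$-modules, each determined by an idempotent matrix over $\mathbb{Z}G$; applying to such a matrix the usual matrix trace to $\mathbb{Z}G$ followed by $\mathrm{HS}$ induces the Hattori-Stallings trace homomorphism $\mathrm{HS}_G:K_0(\mathbb{Z}G)\rightarrow HH_0(\mathbb{Z}G)=\bigoplus_{[s]\in[G]}\mathbb{Z}\cdot[s]$. The Bass conjecture for the group $G$ is the assertion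 that the image of $\mathrm{HS}_G$ is contained in $\mathbb{Z}\cdot[e]$, where $e$ is the identity element of $G$. *)

(* Defs.v *)
From HB Require Import structures.
From mathcomp Require Import all_boot all_algebra finmap.
From mathcomp.classical Require Import boolp.
From mathcomp.multinomials Require Import monalg.

Set Implicit Arguments.
Unset Strict Implicit.
Unset Printing Implicit Defensive.

Import GRing.Theory.

Local Open Scope fset_scope.
Local Open Scope ring_scope.
Local Open Scope quotient_scope.

Definition subgroup_type (G : groupType) (H : groupClosed G) : Type :=
  {x : G | x \in (H : {pred G})}.

HB.instance Definition _ (G : groupType) (H : groupClosed G) :=
  SubChoice.on (subgroup_type H).
Fact subgroup_type_closed (G : groupType) (H : groupClosed G) :
  group_closed (H : {pred G}).
Proof. by split; [exact: gpred1 | exact: gpredF]. Qed.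
HB.instance Definition _ (G : groupType) (H : groupClosed G) :=
  SubChoice_isSubGroup.Build G _ (subgroup_type H)
    (@subgroup_type_closed G H).

Definition finitely_generated (G : groupType) (H : groupClosed G) : Prop :=
  exists s : seq G, {subset s <= (H : {pred G})} /\
    forall K : groupClosed G,
      {subset s <= (K : {pred G})} -> {subset (H : {pred G}) <= (K : {pred G})}.

(* The library's [~ u, v] is u^-1 v^-1 u v, hence not the commutator used here *)
Definition commutator (G : groupType) (u v : G) : G :=
  (u * v * u^-1 * v^-1)%g.

Definition binate (G : groupType) : Prop :=
  (exists g : G, g <> 1%g) /\
  forall H : groupClosed G, finitely_generated H ->
    exists (phi : {multiplicative subgroup_type H -> G}) (u : G),
      forall h : subgroup_type H, \val h = commutator u (phi h).

(* monalg equips {malg R[K]} with a ring structure only for monoids without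
   nontrivial units; the same convolution product is used here for groups. *)
Definition group_ring (G : groupType) : Type := {malg int[G]}.
HB.instance Definition _ (G : groupType) := GRing.Zmodule.on (group_ring G).

Section GroupRing.
Variable G : groupType.
Implicit Types (a b c : group_ring G) (g h : G).

Definition gr_of g : group_ring G := << g >>.
Definition gr_one : group_ring G := gr_of 1%g.
Definition gr_mul a b : group_ring G :=
  \sum_(g <- msupp a) \sum_(h <- msupp b) << a@_g * b@_h *g (g * h)%g >>.

Let gr_mulw (d1 d2 : {fset G}) a b : msupp a `<=` d1 -> msupp b `<=` d2 ->
  gr_mul a b = \sum_(g <- d1) \sum_(h <- d2) << a@_g * b@_h *g (g * h)%g >>.
Proof.
move=> le1 le2; rewrite /gr_mul (big_fset_incl _ le1) /=.
  apply: eq_bigr => g _; apply: big_fset_incl => // k _ /mcoeff_outdom ->.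
  by rewrite mulr0 monalgU0.
move=> k _ /mcoeff_outdom gk.
by rewrite big1 // => k' _; rewrite gk mul0r monalgU0.
Qed.

Let gr_mulDl : left_distributive gr_mul +%R.
Proof.
move=> a b c.
rewrite (gr_mulw (msuppD_le a b) (fsubset_refl (msupp c))).
rewrite (gr_mulw (fsubsetUl (msupp a) (msupp b)) (fsubset_refl _)).
rewrite (gr_mulw (fsubsetUr (msupp a) (msupp b)) (fsubset_refl _)).
rewrite -big_split; apply: eq_bigr => g _ /=.
rewrite -big_split; apply: eq_bigr => h _ /=.
by rewrite mcoeffD mulrDl monalgUD.
Qed.

Let gr_mulDr : right_distributive gr_mul +%R.
Proof.
move=> c a b.
rewrite (gr_mulw (fsubset_refl (msupp c)) (msuppD_le a b)).
rewrite (gr_mulw (fsubset_refl _) (fsubsetUl (msupp a) (msupp b))).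
rewrite (gr_mulw (fsubset_refl _) (fsubsetUr (msupp a) (msupp b))).
rewrite -big_split; apply: eq_bigr => g _ /=.
rewrite -big_split; apply: eq_bigr => h _ /=.
by rewrite mcoeffD mulrDr monalgUD.
Qed.

Let gr_mul0l : left_zero 0 gr_mul.
Proof. by move=> a; rewrite /gr_mul msupp0 big_seq_fset0. Qed.

Let gr_mul0r : right_zero 0 gr_mul.
Proof.
by move=> a; rewrite /gr_mul big1 // => g _; rewrite msupp0 big_seq_fset0.
Qed.

Lemma gr_mulUU m n g h :
  gr_mul << m *g g >> << n *g h >> = << m * n *g (g * h)%g >>.
Proof.
by rewrite (gr_mulw msuppU_le msuppU_le) !big_seq_fset1 !mcoeffUU.
Qed.

Lemma gr_ind (P : group_ring G -> Prop) : P 0 ->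
  (forall a b, P a -> P b -> P (a + b)) ->
  (forall n g, P << n *g g >>) -> forall a, P a.
Proof. by move=> P0 PD PU a; rewrite [a]monalgE; apply: big_ind. Qed.

Let gr_mulA : associative gr_mul.
Proof.
move=> a b c; elim/gr_ind: a => [|a a' IH IH'|m g].
- by rewrite !gr_mul0l.
- by rewrite !gr_mulDl IH IH'.
elim/gr_ind: b => [|b b' IH IH'|n h].
- by rewrite gr_mul0l gr_mul0r gr_mul0l.
- by rewrite gr_mulDl !gr_mulDr gr_mulDl IH IH'.
elim/gr_ind: c => [|c c' IH IH'|p k].
- by rewrite !gr_mul0r.
- by rewrite !gr_mulDr IH IH'.
by rewrite !gr_mulUU mulrA mulgA.
Qed.

Let gr_mul1l : left_id gr_one gr_mul.
Proof.
move=> a; elim/gr_ind: a => [|a a' IH IH'|m g]; first exact: gr_mul0r.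
  by rewrite gr_mulDr IH IH'.
by rewrite gr_mulUU mul1r mul1g.
Qed.

Let gr_mul1r : right_id gr_one gr_mul.
Proof.
move=> a; elim/gr_ind: a => [|a a' IH IH'|m g]; first exact: gr_mul0l.
  by rewrite gr_mulDl IH IH'.
by rewrite gr_mulUU mulr1 mulg1.
Qed.

Let gr_one_neq0 : gr_one != 0.
Proof. by rewrite monalgU_eq0. Qed.

HB.instance Definition _ := GRing.Zmodule_isNzRing.Build (group_ring G)
  gr_mulA gr_mul1l gr_mul1r gr_mulDl gr_mulDr gr_one_neq0.

Lemma gr_mulE (a b : group_ring G) : a * b =
  \sum_(g <- msupp a) \sum_(h <- msupp b) << a@_g * b@_h *g (g * h)%g >>.
Proof. by []. Qed.

Lemma gr_ofM g h : gr_of (g * h)%g = gr_of g * gr_of h.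
Proof. by rewrite /gr_of [RHS]gr_mulUU mulr1. Qed.

Lemma gr_of1 : gr_of 1%g = 1.
Proof. by []. Qed.

End GroupRing.

Section HH0.
Variable G : groupType.

Definition gr_comm : {pred group_ring G} := fun M =>
  `[< forall S : zmodClosed (group_ring G),
      (forall g h : G, gr_of g * gr_of h - gr_of h * gr_of g \in S) ->
      M \in S >].

Fact gr_comm_zmod_closed : zmod_closed gr_comm.
Proof.
split=> [|x y /asboolP xS /asboolP yS]; apply/asboolP => S sS.
  exact: rpred0.
by rewrite rpredB ?xS ?yS.
Qed.
HB.instance Definition _ :=
  GRing.isZmodClosed.Build (group_ring G) gr_comm gr_comm_zmod_closed.

Definition HH0 : Type := Quotient.quot gr_comm.
HB.instance Definition _ := GRing.Zmodule.on HH0.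

Definition HS (M : group_ring G) : HH0 := \pi_(Quotient.quot gr_comm) M.

Fact HS_is_zmod_morphism : zmod_morphism HS.
Proof. by move=> x y; rewrite /HS !piE. Qed.
HB.instance Definition _ :=
  GRing.isZmodMorphism.Build (group_ring G) HH0 HS HS_is_zmod_morphism.

Lemma HS_eq0 M : (HS M == 0) = (M \in gr_comm).
Proof.
by rewrite -[M in RHS]subr0 Quotient.idealrBE -/(HS M) -/(HS 0) raddf0.
Qed.

Lemma HS_mulC (a b : group_ring G) : HS (a * b) = HS (b * a).
Proof.
elim/gr_ind: a => [|a a' IH IH'|m g]; first by rewrite mul0r mulr0.
  by rewrite mulrDl mulrDr !raddfD /= IH IH'.
elim/gr_ind: b => [|b b' IH IH'|n h]; first by rewrite mul0r mulr0.
  by rewrite mulrDl mulrDr !raddfD /= IH IH'.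
have E k (x : G) : << k *g x >> = gr_of x *~ k :> group_ring G.
  by rewrite -(raddfMz (mkmalgU x)) intz.
apply/eqP; rewrite -subr_eq0 -raddfB HS_eq0; apply/asboolP => S sS.
rewrite !E !mulrzAl !mulrzAr -!mulrzA [n * m]mulrC -mulrzBl.
exact/rpredMz/sS.
Qed.

(* The class [s]: it only depends on the conjugacy class of s. *)
Definition conj_class (s : G) : HH0 := HS (gr_of s).

Lemma conj_classJ (s t : G) : conj_class (s ^ t)%g = conj_class s.
Proof.
by rewrite /conj_class conjgE gr_ofM HS_mulC -gr_ofM -mulgA mulgV mulg1.
Qed.
End HH0.

(* A finitely generated projective left R-module is, up to isomorphism, the
   image of an idempotent matrix acting on row vectors from the right. *)
Definition idem (R : nzRingType) : Type :=
  {n : nat & {E : 'M[R]_n | E *m E == E}}.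
HB.instance Definition _ (R : nzRingType) := Choice.on (idem R).

Section Idempotents.
Variable R : nzRingType.

Definition idim (E : idem R) : nat := tag E.
Definition imx (E : idem R) : 'M[R]_(idim E) := val (tagged E).
Lemma imxK (E : idem R) : imx E *m imx E = imx E.
Proof. exact/eqP/(valP (tagged E)). Qed.

Definition mk_idem n (A : 'M[R]_n) (AA : A *m A == A) : idem R :=
  existT _ n (exist _ A AA).

(* As E is idempotent, v lies in its image iff v E = v. *)
Definition in_image (E : idem R) : {pred 'rV[R]_(idim E)} :=
  fun v => v *m imx E == v.
Arguments in_image : clear implicits.
Fact in_image_submod_closed (E : idem R) : submod_closed (in_image E).
Proof.
split=> [|a u v]; rewrite !unfold_in ?mul0mx // => /eqP uE /eqP vE.
by rewrite mulmxDl -scalemxAl uE vE.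
Qed.
HB.instance Definition _ (E : idem R) :=
  GRing.isSubmodClosed.Build R 'rV[R]_(idim E) (in_image E)
    (in_image_submod_closed E).

Definition image (E : idem R) : Type :=
  {v : 'rV[R]_(idim E) | v \in in_image E}.
HB.instance Definition _ (E : idem R) := SubChoice.on (image E).
HB.instance Definition _ (E : idem R) :=
  [SubChoice_isSubZmodule of image E by <:].
HB.instance Definition _ (E : idem R) :=
  [SubZmodule_isSubLmodule of image E by <:].

Fact im_proj_subproof (E : idem R) (v : 'rV[R]_(idim E)) :
  v *m imx E \in in_image E.
Proof. by rewrite unfold_in -mulmxA imxK. Qed.
Definition im_proj (E : idem R) (v : 'rV[R]_(idim E)) : image E :=
  exist (fun w => w \in in_image E) (v *m imx E) (im_proj_subproof v).

Fact im_proj_is_linear (E : idem R) : linear (@im_proj E).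
Proof. by move=> a x y; apply: val_inj; rewrite /= mulmxDl -scalemxAl. Qed.
HB.instance Definition _ (E : idem R) :=
  GRing.isLinear.Build R 'rV[R]_(idim E) (image E) *:%R (@im_proj E)
    (@im_proj_is_linear E).

Lemma im_valP (E : idem R) (w : image E) : val w *m imx E = val w.
Proof. exact: (eqP (valP w)). Qed.

Lemma im_projK (E : idem R) (w : image E) : im_proj (val w) = w.
Proof. by apply: val_inj; rewrite /= im_valP. Qed.

Definition lmod_iso (U V : lmodType R) : Prop :=
  exists f : {linear U -> V}, bijective f.

Lemma lmod_iso_intro (U V : lmodType R) (f : U -> V) (g : V -> U) :
  linear f -> cancel f g -> cancel g f -> lmod_iso U V.
Proof.
move=> f_lin fK gK.
pose fL := HB.pack_for {linear U -> V} f (GRing.isLinear.Build R U V *:%R f f_lin).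
by exists fL, g.
Qed.

Lemma lmod_iso_refl U : lmod_iso U U.
Proof. by apply: (@lmod_iso_intro _ _ id id). Qed.

Lemma lmod_iso_sym U V : lmod_iso U V -> lmod_iso V U.
Proof.
case=> f [g fK gK]; apply: (@lmod_iso_intro _ _ g f) => // a x y.
by apply: (can_inj fK); rewrite gK linearP !gK.
Qed.

Lemma lmod_iso_trans U V W : lmod_iso U V -> lmod_iso V W -> lmod_iso U W.
Proof.
case=> f [f' fK f'K] [g [g' gK g'K]].
apply: (@lmod_iso_intro _ _ (g \o f) (f' \o g')).
- by move=> a x y; rewrite /= !linearP.
- by move=> x; rewrite /= gK fK.
- by move=> x; rewrite /= f'K g'K.
Qed.

Lemma lmod_iso_prod U V U' V' : lmod_iso U U' -> lmod_iso V V' ->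
  lmod_iso (U * V)%type (U' * V')%type.
Proof.
case=> f [f' fK f'K] [g [g' gK g'K]].
apply: (@lmod_iso_intro _ _ (fun x : (U * V)%type => (f x.1, g x.2))
                            (fun x : (U' * V')%type => (f' x.1, g' x.2))).
- by move=> a x y; rewrite /= !linearP.
- by move=> x; rewrite /= fK gK -surjective_pairing.
- by move=> x; rewrite /= f'K g'K -surjective_pairing.
Qed.

Lemma lmod_iso_prodC (U V : lmodType R) : lmod_iso (U * V)%type (V * U)%type.
Proof.
by apply: (@lmod_iso_intro _ _ (fun x : (U * V)%type => (x.2, x.1))
                            (fun x : (V * U)%type => (x.2, x.1))) => // -[].
Qed.

Lemma lmod_iso_prodA (U V W : lmodType R) :
  lmod_iso (U * (V * W))%type (U * V * W)%type.
Proof.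
apply: (@lmod_iso_intro _ _
  (fun x : (U * (V * W))%type => (x.1, x.2.1, x.2.2))
  (fun x : (U * V * W)%type => (x.1.1, (x.1.2, x.2)))) => //.
  by case=> ? [].
by case=> [] [].
Qed.

Definition idem_iso (E F : idem R) : bool := `[< lmod_iso (image E) (image F) >].

Fact idem_iso_equiv : equiv_class_of idem_iso.
Proof.
split=> [E|E F|F E H /asboolP EF /asboolP FH].
- exact/asboolP/lmod_iso_refl.
- by apply/asboolP/asboolP; exact: lmod_iso_sym.
- exact/asboolP/(lmod_iso_trans EF FH).
Qed.
Canonical idem_iso_equiv_rel := EquivRelPack idem_iso_equiv.

Fact idem0_subproof : (0 : 'M[R]_0) *m (0 : 'M[R]_0) == 0.
Proof. by rewrite mulmx0. Qed.
Definition idem0 : idem R := mk_idem idem0_subproof.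

Fact idem_sum_subproof (E F : idem R) :
  block_mx (imx E) 0 0 (imx F) *m block_mx (imx E) 0 0 (imx F) ==
  block_mx (imx E) 0 0 (imx F).
Proof. by rewrite mulmx_block !(mulmx0, mul0mx, addr0, add0r) !imxK. Qed.
Definition idem_sum (E F : idem R) : idem R := mk_idem (idem_sum_subproof E F).

Lemma image_sum (E F : idem R) :
  lmod_iso (image (idem_sum E F)) (image E * image F)%type.
Proof.
pose f (v : image (idem_sum E F)) : (image E * image F)%type :=
  (@im_proj E (lsubmx (val v : 'rV_(idim E + idim F))),
   @im_proj F (rsubmx (val v : 'rV_(idim E + idim F)))).
pose g (x : (image E * image F)%type) : image (idem_sum E F) :=
  @im_proj (idem_sum E F) (row_mx (val x.1) (val x.2)).
have sumE (w : 'rV_(idim E + idim F)) :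
    w *m block_mx (imx E) 0 0 (imx F) =
    row_mx (lsubmx w *m imx E) (rsubmx w *m imx F).
  by rewrite -{1}[w]hsubmxK mul_row_block !mulmx0 addr0 add0r.
have gE x : val (g x) = row_mx (val x.1) (val x.2).
  rewrite /= {1}/imx /= mul_row_block !mulmx0 addr0 add0r.
  by rewrite !im_valP.
apply: (@lmod_iso_intro _ _ f g).
- by move=> a x y; congr (_, _); rewrite !linearP.
- move=> v; apply: val_inj; rewrite gE /=.
  exact: etrans (esym (sumE _)) (im_valP v).
- move=> x; rewrite /f gE row_mxKl row_mxKr !im_projK.
  by rewrite -surjective_pairing.
Qed.

Lemma image0 (x y : image idem0) : x = y.
Proof. by apply: val_inj; apply/rowP => -[]. Qed.

Definition proj_class : Type := {eq_quot idem_iso}.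
HB.instance Definition _ := Choice.on proj_class.
HB.instance Definition _ := EqQuotient.on proj_class.

Lemma proj_classP (E F : idem R) :
  lmod_iso (image E) (image F) <-> \pi_proj_class E = \pi_proj_class F.
Proof.
split=> [EF|/eqP]; first by apply/eqP; rewrite piE; apply/asboolP.
by rewrite piE => /asboolP.
Qed.

Definition proj_zero : proj_class := \pi_proj_class idem0.
Definition proj_add (x y : proj_class) : proj_class :=
  \pi_proj_class (idem_sum (repr x) (repr y)).

Lemma proj_addE (E F : idem R) :
  proj_add (\pi_proj_class E) (\pi_proj_class F) =
  \pi_proj_class (idem_sum E F).
Proof.
apply/proj_classP.
apply: lmod_iso_trans (image_sum _ _) _.
apply: lmod_iso_trans _ (lmod_iso_sym (image_sum _ _)).
by apply: lmod_iso_prod; apply/proj_classP; rewrite reprK.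
Qed.

Let proj_addA : associative proj_add.
Proof.
move=> x y z; rewrite -[x]reprK -[y]reprK -[z]reprK.
move: (repr x) (repr y) (repr z) => E F H.
rewrite (proj_addE F H) (proj_addE E F) (proj_addE E) (proj_addE _ H).
apply/proj_classP; apply: lmod_iso_trans (image_sum _ _) _.
apply: lmod_iso_trans _ (lmod_iso_sym (image_sum _ _)).
apply: lmod_iso_trans (lmod_iso_prod (lmod_iso_refl _) (image_sum _ _)) _.
apply: lmod_iso_trans (lmod_iso_prodA _ _ _) _.
exact: lmod_iso_prod (lmod_iso_sym (image_sum _ _)) (lmod_iso_refl _).
Qed.

Let proj_addC : commutative proj_add.
Proof.
move=> x y; rewrite -[x]reprK -[y]reprK.
move: (repr x) (repr y) => E F; rewrite !proj_addE.
apply/proj_classP; apply: lmod_iso_trans (image_sum _ _) _.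
exact: lmod_iso_trans (lmod_iso_prodC _ _) (lmod_iso_sym (image_sum _ _)).
Qed.

Let proj_add0 : left_id proj_zero proj_add.
Proof.
move=> x; rewrite -[x]reprK; move: (repr x) => E; rewrite proj_addE.
apply/proj_classP; apply: lmod_iso_trans (image_sum _ _) _.
apply: (@lmod_iso_intro _ _ (fun x : (image idem0 * image E)%type => x.2)
                            (fun x : image E => (0, x))) => //.
by case=> u v; rewrite (image0 u 0).
Qed.

HB.instance Definition _ := GRing.isNmodule.Build proj_class
  proj_addA proj_addC proj_add0.

Lemma pi_idem_sum (E F : idem R) :
  \pi_proj_class (idem_sum E F) = \pi_proj_class E + \pi_proj_class F.
Proof. by rewrite -proj_addE. Qed.
End Idempotents.

(* The Grothendieck group of a commutative monoid. *)
Section Grothendieck.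
Variable V : nmodType.

Definition groth_equiv (x y : V * V) : bool :=
  `[< exists t, x.1 + y.2 + t = y.1 + x.2 + t >].

Fact groth_equiv_equiv : equiv_class_of groth_equiv.
Proof.
split=> [x|x y|y x z /asboolP[s xy] /asboolP[t yz]].
- by apply/asboolP; exists 0.
- by apply/asboolP/asboolP => -[t xy]; exists t.
apply/asboolP; exists (y.1 + y.2 + s + t).
rewrite !addrA [LHS](ACl ((1*4*5)*(3*2*6)))/= xy yz.
by rewrite !addrA [LHS](ACl (4*2*1*5*3*6))/=.
Qed.
Canonical groth_equiv_rel := EquivRelPack groth_equiv_equiv.

Definition groth : Type := {eq_quot groth_equiv}.
HB.instance Definition _ := Choice.on groth.
HB.instance Definition _ := EqQuotient.on groth.

Definition gdiff (x y : V) : groth := \pi_groth (x, y).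

Lemma gdiffP (x y x' y' : V) :
  gdiff x y = gdiff x' y' <-> exists t, x + y' + t = x' + y + t.
Proof.
split=> [/eqP|xy]; last by apply/eqP; rewrite piE; apply/asboolP.
by rewrite piE => /asboolP.
Qed.

Lemma gdiffE (x : groth) : x = gdiff (repr x).1 (repr x).2.
Proof. by rewrite /gdiff -surjective_pairing reprK. Qed.

Definition groth_zero : groth := gdiff 0 0.
Definition groth_opp (x : groth) : groth := gdiff (repr x).2 (repr x).1.
Definition groth_add (x y : groth) : groth :=
  gdiff ((repr x).1 + (repr y).1) ((repr x).2 + (repr y).2).

Lemma groth_oppE x y : groth_opp (gdiff x y) = gdiff y x.
Proof.
rewrite /groth_opp; apply/gdiffP.
have /gdiffP[t E] := gdiffE (gdiff x y); exists t.
by rewrite [LHS](ACl (2*1*3))/= E [RHS](ACl (2*1*3)).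
Qed.

Lemma groth_addE x y x' y' :
  groth_add (gdiff x y) (gdiff x' y') = gdiff (x + x') (y + y').
Proof.
rewrite /groth_add; apply/gdiffP.
have /gdiffP[t E] := gdiffE (gdiff x y).
have /gdiffP[t' E'] := gdiffE (gdiff x' y'); exists (t + t').
rewrite !addrA [LHS](ACl ((1*3*5)*(2*4*6)))/= -E -E'.
by rewrite !addrA [LHS](ACl (1*4*2*5*3*6))/=.
Qed.

Let groth_addA : associative groth_add.
Proof.
by move=> x y z; rewrite [x]gdiffE [y]gdiffE [z]gdiffE !groth_addE !addrA.
Qed.

Let groth_addC : commutative groth_add.
Proof.
move=> x y; rewrite [x]gdiffE [y]gdiffE !groth_addE.
by rewrite [_.1 + _]addrC [_.2 + _]addrC.
Qed.

Let groth_add0 : left_id groth_zero groth_add.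
Proof. by move=> x; rewrite [x]gdiffE !groth_addE !add0r. Qed.

Let groth_addN : left_inverse groth_zero groth_opp groth_add.
Proof.
move=> x; rewrite [x]gdiffE groth_oppE groth_addE; apply/gdiffP; exists 0.
by rewrite !addr0 add0r addrC.
Qed.

HB.instance Definition _ := GRing.isZmodule.Build groth
  groth_addA groth_addC groth_add0 groth_addN.

Variables (W : zmodType) (f : {additive V -> W}).

Definition groth_lift (x : groth) : W := f (repr x).1 - f (repr x).2.

Lemma groth_liftE x y : groth_lift (gdiff x y) = f x - f y.
Proof.
have /gdiffP[t E] := gdiffE (gdiff x y).
have /(congr1 (fun w => w - f t)) := congr1 f E.
rewrite !raddfD !addrK /= => {}E.
by apply/eqP; rewrite /groth_lift subr_eq addrAC eq_sym subr_eq addrC -E addrC.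
Qed.

Fact groth_lift_is_zmod_morphism : zmod_morphism groth_lift.
Proof.
move=> x y; rewrite [x]gdiffE [y]gdiffE.
have -> a b c d : gdiff a b - gdiff c d = gdiff (a + d) (b + c).
  by rewrite -groth_addE -(groth_oppE c d).
by rewrite !groth_liftE !raddfD /= opprK !addrA [RHS](ACl (1*4*2*3)).
Qed.
HB.instance Definition _ :=
  GRing.isZmodMorphism.Build groth W groth_lift groth_lift_is_zmod_morphism.
End Grothendieck.

(* [image E] - [image F] is gdiff (\pi E) (\pi F). *)
Definition K0 (R : nzRingType) : Type := groth (proj_class R).
HB.instance Definition _ (R : nzRingType) := GRing.Zmodule.on (K0 R).

Section HattoriStallings.
Variable G : groupType.
Let ZG : nzRingType := group_ring G.

Definition HS_class (x : proj_class ZG) : HH0 G := HS (\tr (imx (repr x))).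

Lemma HS_mxtrace_mulC m n (X : 'M[ZG]_(m, n)) (Y : 'M[ZG]_(n, m)) :
  HS (\tr (X *m Y)) = HS (\tr (Y *m X)).
Proof.
have E p q (A : 'M[ZG]_(p, q)) (B : 'M[ZG]_(q, p)) :
    HS (\tr (A *m B)) = \sum_i \sum_j HS (A i j * B j i).
  rewrite /mxtrace raddf_sum; apply: eq_bigr => i _.
  by rewrite mxE raddf_sum.
rewrite !E exchange_big; apply: eq_bigr => i _; apply: eq_bigr => j _.
exact: HS_mulC.
Qed.

Lemma HS_trace_iso (E F : idem ZG) :
  lmod_iso (image E) (image F) -> HS (\tr (imx E)) = HS (\tr (imx F)).
Proof.
case=> f [g fK gK].
have g_lin : linear g.
  by move=> a x y; apply: (can_inj fK); rewrite gK linearP !gK.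
have mxlin (A B : idem ZG) (k : image A -> image B) : linear k ->
    exists X : 'M_(idim A, idim B), forall v, v *m X = val (k (im_proj v)).
  move=> k_lin.
  pose k' (v : 'rV_(idim A)) : 'rV_(idim B) := val (k (im_proj v)).
  have k'_lin : linear k'.
    by move=> a x y; rewrite /k' linearP k_lin linearP.
  pose kL := HB.pack_for {linear 'rV_(idim A) -> 'rV_(idim B)} k'
    (GRing.isLinear.Build ZG 'rV_(idim A) 'rV_(idim B) *:%R k' k'_lin).
  by exists (lin1_mx kL) => v; rewrite mul_rV_lin1.
have [X XE] := mxlin _ _ _ (linearP f); have [Y YE] := mxlin _ _ _ g_lin.
have XY : X *m Y = imx E.
  by apply/row_matrixP => i; rewrite !rowE mulmxA XE YE im_projK fK.
have YX : Y *m X = imx F.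
  by apply/row_matrixP => i; rewrite !rowE mulmxA YE XE im_projK gK.
by rewrite -XY -YX HS_mxtrace_mulC.
Qed.

Lemma HS_classE (E : idem ZG) : HS_class (\pi_(proj_class ZG) E) = HS (\tr (imx E)).
Proof. by apply: HS_trace_iso; apply/proj_classP; rewrite reprK. Qed.

Fact HS_class_is_nmod_morphism : nmod_morphism HS_class.
Proof.
split=> [|x y].
  rewrite -[0]/(\pi_(proj_class ZG) (idem0 ZG)) HS_classE.
  by rewrite /mxtrace big_ord0 raddf0.
rewrite -[x]reprK -[y]reprK -pi_idem_sum !HS_classE.
by rewrite [imx _]/(block_mx _ _ _ _) mxtrace_block raddfD.
Qed.
HB.instance Definition _ := GRing.isNmodMorphism.Build (proj_class ZG) (HH0 G)
  HS_class HS_class_is_nmod_morphism.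

Definition HS_K0 : K0 ZG -> HH0 G := groth_lift HS_class.
HB.instance Definition _ := GRing.Additive.on HS_K0.

Lemma HS_K0E (E F : idem ZG) :
  HS_K0 (gdiff (\pi_(proj_class ZG) E) (\pi_(proj_class ZG) F)) = HS (\tr (imx E)) - HS (\tr (imx F)).
Proof. by rewrite /HS_K0 groth_liftE /= !HS_classE. Qed.

Definition bass_conjecture : Prop :=
  forall x : K0 ZG, exists n : int, HS_K0 x = conj_class 1%g *~ n.
End HattoriStallings.

(* Main.v *)
Require Import Defs.
From mathcomp Require Import all_boot.
From HB Require Import structures.
From mathcomp Require Import all_order all_algebra finmap zify.
From mathcomp.classical Require Import boolp.
From mathcomp.multinomials Require Import monalg.

Set Implicit Arguments.
Unset Strict Implicit.
Unset Printing Implicit Defensive.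

Import GRing.Theory Num.Theory Order.TTheory.

Local Open Scope fset_scope.
Local Open Scope ring_scope.
Local Open Scope quotient_scope.

(** The Bass conjecture passes from B to G as soon as G embeds in B without
    merging conjugacy classes: then HH_0(ZG) is a direct summand of HH_0(ZB),
    so the trace of a projective ZG-module is determined by the trace of the
    module that it induces over ZB ([bass_conjecture_pullback]).  It therefore
    suffices to embed every group G in a binate group in this way.

    Such a binate group can be written down in one step, as a permutational
    wreath product of G with a group of permutations of an index set I.  Place
    one copy of G on each index, and let B consist of the permutations of
    G * I that commute with the right multiplication by G and have bounded
    support; an element of B permutes the copies of G and acts on each by a
    left multiplication.  Then G acts on the copy at a base point of I, and an
    element of B that conjugates g to h either fixes the base point, in which
    case its component there conjugates g to h in G, or moves it, in which
    case g and h are both trivial ([embed_conj]).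

    Boundedness is designed for an infinite product trick.  Take
    I = Z[X], and call a permutation bounded by N if it fixes all points over
    polynomials having more than N coefficients.  The translation v by X^N
    (restricted to the polynomials having at most N+1 coefficients) is bounded
    by N+1, and it carries the polynomials having at most N coefficients
    through infinitely many disjoint layers, indexed by the coefficient of
    X^N.  If h is bounded by N, then the infinite product
      phi(h) = prod_(k >= 1) v^k h v^-k
    is therefore defined, bounded by N+1, and multiplicative in h; and
    v^-1 phi(h) v = prod_(k >= 0) v^k h v^-k = h phi(h), which says that h is
    the commutator of v^-1 and phi(h) ([swindle_shift]).  Finitely many
    elements of B have a common bound, so B is binate ([bperm_binate]). *)

(** * Additive functionals on group rings *)

Section Extension.
Variables (G : groupType) (V : zmodType) (f : G -> V).

Definition gr_ext (a : group_ring G) : V := \sum_(g <- msupp a) f g *~ a@_g.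

Lemma gr_ext_widen (d : {fset G}) (a : group_ring G) :
  msupp a `<=` d -> gr_ext a = \sum_(g <- d) f g *~ a@_g.
Proof.
move=> le; apply: big_fset_incl => // g _ /mcoeff_outdom ->.
by rewrite mulr0z.
Qed.

Fact gr_ext_is_zmod_morphism : zmod_morphism gr_ext.
Proof.
move=> a b.
rewrite (gr_ext_widen (msuppB_le a b)).
rewrite (gr_ext_widen (fsubsetUl (msupp a) (msupp b))).
rewrite (gr_ext_widen (fsubsetUr (msupp a) (msupp b))).
rewrite -sumrB; apply: eq_bigr => g _.
by rewrite mcoeffB mulrzBr.
Qed.
HB.instance Definition _ :=
  GRing.isZmodMorphism.Build (group_ring G) V gr_ext gr_ext_is_zmod_morphism.

Lemma gr_extU n g : gr_ext << n *g g >> = f g *~ n.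
Proof. by rewrite (gr_ext_widen msuppU_le) big_seq_fset1 mcoeffUU. Qed.

Lemma gr_ext_of g : gr_ext (gr_of g) = f g.
Proof. exact: gr_extU. Qed.

(** Only class functions descend to HH_0, since gh and hg are conjugate. *)
Lemma gr_ext_gr_comm (a : group_ring G) :
  (forall g h, f (g ^ h)%g = f g) -> a \in gr_comm (G:=G) -> gr_ext a = 0.
Proof.
move=> fJ /asboolP aS.
pose K : {pred group_ring G} := fun b => gr_ext b == 0.
have K_closed : zmod_closed K.
  split=> [|b c]; rewrite !unfold_in ?raddf0 // => /eqP b0 /eqP c0.
  by rewrite raddfB /= b0 c0 subr0.
pose KC := HB.pack_for (zmodClosed (group_ring G)) K
  (GRing.isZmodClosed.Build (group_ring G) K K_closed).
apply/eqP; apply: (aS KC) => g h.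
rewrite unfold_in /= /K raddfB /= -!gr_ofM !gr_ext_of subr_eq0.
by rewrite -(fJ (h * g)%g h) conjgE -mulgA mulKg.
Qed.
End Extension.

(** * Transfer along an embedding that separates conjugacy classes *)

Section Functoriality.
Variables (G B : groupType) (i : UMagmaMorphism.type G B).

Definition gr_map : group_ring G -> group_ring B :=
  gr_ext (fun g => gr_of (i g)).
HB.instance Definition _ := GRing.Additive.on gr_map.

Lemma gr_map_of g : gr_map (gr_of g) = gr_of (i g).
Proof. exact: gr_ext_of. Qed.

Fact gr_map_is_monoid_morphism : monoid_morphism gr_map.
Proof.
split=> [|a b]; first by rewrite -gr_of1 gr_map_of gmulf1.
elim/gr_ind: a => [|a a' IH IH'|m g]; first by rewrite mul0r raddf0 mul0r.
  by rewrite mulrDl !raddfD /= IH IH' mulrDl.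
elim/gr_ind: b => [|b b' IH IH'|n h]; first by rewrite mulr0 raddf0 mulr0.
  by rewrite mulrDr !raddfD /= IH IH' mulrDr.
rewrite [_ * _]gr_mulUU /gr_map !gr_extU /= gmulfM gr_ofM.
by rewrite mulrzAl mulrzAr -mulrzA mulrC.
Qed.
HB.instance Definition _ := GRing.isMonoidMorphism.Build
  (group_ring G) (group_ring B) gr_map gr_map_is_monoid_morphism.

Fact idem_map_subproof (E : idem (group_ring G)) :
  map_mx gr_map (imx E) *m map_mx gr_map (imx E) == map_mx gr_map (imx E).
Proof. by rewrite -map_mxM imxK. Qed.
Definition idem_map (E : idem (group_ring G)) : idem (group_ring B) :=
  mk_idem (idem_map_subproof E).

Hypothesis i_conj : forall g h b, (i g = i h ^ b)%g -> exists c, (g = h ^ c)%g.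

(** On basis elements, the projection of HH_0(ZB) onto its summand HH_0(ZG);
    the class of the chosen element of G does not depend on the choice, because
    the embedding separates conjugacy classes. *)
Definition class_retract (b : B) : HH0 G :=
  if pselect (exists gc : G * B, b = (i gc.1 ^ gc.2)%g) is left e
  then conj_class (projT1 (cid e)).1 else 0.

Lemma class_retract_conj g c : class_retract (i g ^ c)%g = conj_class g.
Proof.
rewrite /class_retract; case: pselect => [e|[]]; last by exists (g, c).
case: cid => -[h d] /= /(canLR (conjgK _)); rewrite -conjgM.
move=> /esym/i_conj[z ->].
exact: conj_classJ.
Qed.

Lemma class_retractJ b c : class_retract (b ^ c)%g = class_retract b.
Proof.
have [[[g d] /= ->]|nb] := pselect (exists gd : G * B, b = (i gd.1 ^ gd.2)%g).
  by rewrite -conjgM !class_retract_conj.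
rewrite {2}/class_retract; case: pselect => // _.
rewrite /class_retract; case: pselect => // -[[g d] /= bE].
by case: nb; exists (g, d / c)%g; rewrite /= conjgM -bE conjgK.
Qed.

Lemma class_retract_map (a : group_ring G) :
  gr_ext class_retract (gr_map a) = HS a.
Proof.
elim/gr_ind: a => [|a b IHa IHb|n g]; first by rewrite !raddf0.
  by rewrite !raddfD /= IHa IHb.
have -> : << n *g g >> = gr_of g *~ n :> group_ring G.
  by rewrite -(raddfMz (mkmalgU g)) intz.
rewrite !raddfMz /= gr_map_of gr_ext_of -[i g]conjg1.
by rewrite class_retract_conj.
Qed.

(** The retraction recovers the trace of (E, F) from that of the induced pair,
    and it sends the class of 1 to the class of 1. *)
Lemma bass_conjecture_pullback : bass_conjecture B -> bass_conjecture G.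
Proof.
move=> bassB ZG x; rewrite {}/ZG in x *; rewrite (gdiffE x).
rewrite -[(repr x).1]reprK -[(repr x).2]reprK.
move: (repr (repr x).1) (repr (repr x).2) => E F; rewrite HS_K0E.
have [n Hn] := bassB (gdiff (\pi_(proj_class (group_ring B)) (idem_map E))
                         (\pi_(proj_class (group_ring B)) (idem_map F))).
exists n; move: Hn; rewrite HS_K0E /= !trace_map_mx.
have -> : conj_class (1%g : B) = HS (gr_map 1) by rewrite rmorph1.
rewrite -[conj_class _]/(HS 1) -!raddfMz -!raddfB /= => /eqP.
rewrite -subr_eq0 -!raddfB HS_eq0 => /(gr_ext_gr_comm class_retractJ).
by rewrite class_retract_map raddfB => /subr0_eq.
Qed.
End Functoriality.

(** * Bounded permutations of the copies of a group *)

Section BinateHull.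
Variable G : groupType.

(** A copy of G for each integer polynomial.  The index set only needs an
    increasing sequence of subsets, each with infinitely many disjoint
    translates inside the next; the submodules of polynomials of bounded size
    provide them explicitly. *)
Definition fibre : Type := (G * {poly int})%type.
Implicit Types (x : fibre) (N : nat).

Definition ract (g : G) x : fibre := ((x.1 * g)%g, x.2).
Definition below N x := (size x.2 <= N)%N.
Definition fixes_above N (f : fibre -> fibre) :=
  forall x, ~~ below N x -> f x = x.

(** Commutation with the right multiplications confines each element to act
    by left multiplications between copies of G; without it, all elements of G
    of the same order would become conjugate. *)
Record bperm : Type := BPerm {
  bfun :> fibre -> fibre;
  binv : fibre -> fibre;
  bfunK : cancel bfun binv;
  binvK : cancel binv bfun;
  bfun_ract : forall g x, bfun (ract g x) = ract g (bfun x);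
  bfun_bounded : exists N, fixes_above N bfun
}.

HB.instance Definition _ := gen_eqMixin bperm.
HB.instance Definition _ := gen_choiceMixin bperm.

Lemma bperm_eq (f g : bperm) : f =1 g -> f = g.
Proof.
move=> fg.
have finvg : binv f = binv g.
  by apply/funext => x; apply: (can_inj (bfunK f)); rewrite binvK fg binvK.
move/funext: fg finvg.
case: f => f f' fK f'K fr fb; case: g => g g' gK g'K gr gb /= E E'.
case: g / E gK g'K gr gb; case: g' / E' => *.
by congr BPerm; apply: Prop_irrelevance.
Qed.

Lemma below_ract N g x : below N (ract g x) = below N x. Proof. by []. Qed.

Lemma bfun_inj (f : bperm) : injective f. Proof. exact: can_inj (bfunK f). Qed.

Fact fixes_above_cancel N (f : bperm) :
  fixes_above N f -> fixes_above N (binv f).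
Proof. by move=> fN x xN; rewrite -{1}(fN x xN) bfunK. Qed.

Lemma fixes_above_leq N N' f :
  (N <= N')%N -> fixes_above N f -> fixes_above N' f.
Proof.
move=> le fN x; rewrite -ltnNge => lx.
by rewrite fN // -ltnNge (leq_ltn_trans le).
Qed.

Lemma fixes_above_comp N f g :
  fixes_above N f -> fixes_above N g -> fixes_above N (f \o g).
Proof. by move=> fN gN x xN; rewrite /= gN // fN. Qed.

Definition bone : bperm.
Proof. by apply: (@BPerm id id) => //; exists 0. Defined.

Definition bmul (f g : bperm) : bperm.
Proof.
apply: (@BPerm (f \o g) (binv g \o binv f)).
- exact: can_comp (bfunK f) (bfunK g).
- exact: can_comp (binvK g) (binvK f).
- by move=> a x; rewrite /= !bfun_ract.
have [M fM] := bfun_bounded f; have [N gN] := bfun_bounded g.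
exists (maxn M N); apply: fixes_above_comp.
  exact: fixes_above_leq (leq_maxl _ _) fM.
exact: fixes_above_leq (leq_maxr _ _) gN.
Defined.

Definition bpermV (f : bperm) : bperm.
Proof.
apply: (@BPerm (binv f) f).
- exact: binvK.
- exact: bfunK.
- by move=> a x; apply: (@bfun_inj f); rewrite bfun_ract !binvK.
by have [N fN] := bfun_bounded f; exists N; apply: fixes_above_cancel.
Defined.

Fact bmulA : associative bmul. Proof. by move=> *; apply: bperm_eq. Qed.
Fact bmul1 : left_id bone bmul. Proof. by move=> *; apply: bperm_eq. Qed.
Fact bmulr1 : right_id bone bmul. Proof. by move=> *; apply: bperm_eq. Qed.
Fact bmulV : left_inverse bone bpermV bmul.
Proof. by move=> f; apply: bperm_eq => x; apply: bfunK. Qed.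
Fact bmulrV : right_inverse bone bpermV bmul.
Proof. by move=> f; apply: bperm_eq => x; apply: binvK. Qed.

HB.instance Definition _ := isGroup.Build bperm bmulA bmul1 bmulr1 bmulV bmulrV.

Lemma bpermM (f g : bperm) x : (f * g)%g x = f (g x). Proof. by []. Qed.
Lemma bperm1 x : (1%g : bperm) x = x. Proof. by []. Qed.

(** * The infinite product trick *)

Section Level.
Variable N : nat.

Definition supp_below : {pred bperm} := fun f => `[< fixes_above N f >].

Fact supp_belowM : mulg_closed supp_below.
Proof.
by move=> f g /asboolP fN /asboolP gN; apply/asboolP/fixes_above_comp.
Qed.
Fact supp_below1 : 1%g \in supp_below. Proof. by apply/asboolP => x. Qed.
Fact supp_belowV : invg_closed supp_below.
Proof. by move=> f /asboolP fN; apply/asboolP/fixes_above_cancel. Qed.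
HB.instance Definition _ := isMulClosed.Build bperm supp_below supp_belowM.
HB.instance Definition _ := isMul1Closed.Build bperm supp_below supp_below1.
HB.instance Definition _ := isInvClosed.Build bperm supp_below supp_belowV.

Lemma below_supp (f : bperm) x : f \in supp_below -> below N (f x) = below N x.
Proof.
move=> /asboolP fN.
case: (boolP (below N x)) => [xN|/[dup] /negPf xN /fN ->] //.
apply: contraT => /[dup] fxN /fN /bfun_inj fxx.
by rewrite fxx xN in fxN.
Qed.

Definition translate (k : int) x : fibre := (x.1, x.2 + k *: 'X^N).
Definition layer x : int := x.2`_N.

Lemma translateD k l x : translate (k + l) x = translate k (translate l x).
Proof. by rewrite /translate /= scalerDl addrAC addrA. Qed.
Lemma translate0 x : translate 0 x = x.
Proof. by rewrite /translate scale0r addr0 -surjective_pairing. Qed.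
Lemma translateK k : cancel (translate k) (translate (- k)).
Proof. by move=> x; rewrite -translateD addNr translate0. Qed.
Lemma translate_ract k g x : translate k (ract g x) = ract g (translate k x).
Proof. by []. Qed.
Lemma layer_ract g x : layer (ract g x) = layer x. Proof. by []. Qed.
Lemma layer_translate k x : layer (translate k x) = layer x + k.
Proof. by rewrite /layer coefD coefZ coefXn eqxx mulr1. Qed.
Lemma below_translate k x : below N.+1 x -> below N.+1 (translate k x).
Proof.
move=> xN; apply: leq_trans (size_polyD _ _) _; rewrite geq_max.
apply/andP; split; first exact: xN.
by apply: leq_trans (size_scale_leq _ _) _; rewrite size_polyXn.
Qed.

(** Hence the layers of level N+1 are translates of level N: subtracting its
    multiple of X^N brings any point of level N+1 back to where the elements
    bounded by N act. *)
Lemma below_layer x : below N x = below N.+1 x && (layer x == 0).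
Proof.
apply/idP/andP => [xN|[/leq_sizeP xN /eqP x0]].
  by split; [exact: leqW | apply/eqP; rewrite /layer (leq_sizeP _ _ xN)].
by apply/leq_sizeP => j; rewrite leq_eqVlt => /predU1P[<- //|]; apply: xN.
Qed.

Lemma below_base x : below N.+1 x -> below N (translate (- layer x) x).
Proof.
by move=> xN; rewrite below_layer below_translate //= layer_translate subrr.
Qed.

Definition shift_fun k x := if below N.+1 x then translate k x else x.

Lemma shift_funK k : cancel (shift_fun k) (shift_fun (- k)).
Proof.
move=> x; rewrite /shift_fun; case: (boolP (below _ x)) => [xN|/negPf-> //].
by rewrite below_translate // translateK.
Qed.

Definition shift : bperm.
Proof.
apply: (@BPerm (shift_fun 1) (shift_fun (- 1))).
- exact: shift_funK.
- by have := @shift_funK (- 1); rewrite opprK.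
- by move=> g x; rewrite /shift_fun below_ract; case: ifP.
by exists N.+1 => x /negPf xN; rewrite /shift_fun xN.
Defined.

(** The product of the conjugates of f by the translations by k, for k >= 1:
    as these have disjoint supports, only the factor with k equal to the layer
    of x moves x. *)
Definition swindle_fun (f : bperm) x :=
  if below N.+1 x && (0 < layer x)
  then translate (layer x) (f (translate (- layer x) x)) else x.

(** Each layer is stable under the infinite product; hence the product may be
    computed layer by layer. *)
Lemma swindle_funP f x : f \in supp_below -> below N.+1 x ->
  below N.+1 (swindle_fun f x) /\ layer (swindle_fun f x) = layer x.
Proof.
move=> fN xN; rewrite /swindle_fun xN /=; case: ifP => // _.
have := below_base xN.
rewrite -(below_supp _ fN) below_layer => /andP[bN /eqP l0].
by rewrite below_translate // layer_translate l0 add0r.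
Qed.

Lemma swindle_funM f g : f \in supp_below -> g \in supp_below ->
  swindle_fun (f * g)%g =1 swindle_fun f \o swindle_fun g.
Proof.
move=> fN gN x /=.
have [xN|xN] := boolP (below N.+1 x); last by rewrite /swindle_fun !(negPf xN).
have [yN yl] := swindle_funP gN xN.
rewrite {2}/swindle_fun yN yl {1}/swindle_fun xN /=.
rewrite /swindle_fun xN /=; case: ifP => // _.
by rewrite translateK.
Qed.

Lemma swindle_fun1 : swindle_fun 1%g =1 id.
Proof.
move=> x; rewrite /swindle_fun; case: ifP => // _.
by rewrite bperm1 -translateD subrr translate0.
Qed.

Definition swindle (f : bperm) (fN : f \in supp_below) : bperm.
Proof.
apply: (@BPerm (swindle_fun f) (swindle_fun (f^-1)%g)).
- by move=> x; rewrite -[LHS]swindle_funM ?supp_belowV // mulVg swindle_fun1.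
- by move=> x; rewrite -[LHS]swindle_funM ?supp_belowV // mulgV swindle_fun1.
- move=> g x; rewrite /swindle_fun below_ract layer_ract.
  by case: ifP => // _; rewrite translate_ract bfun_ract translate_ract.
by exists N.+1 => x /negPf xN; rewrite /swindle_fun xN.
Defined.

Lemma swindleM f g (fN : f \in supp_below) (gN : g \in supp_below)
    (fgN : (f * g)%g \in supp_below) :
  swindle fgN = (swindle fN * swindle gN)%g.
Proof. by apply: bperm_eq; apply: swindle_funM. Qed.

(** Conjugating the product over k >= 1 by the inverse of the shift lowers all
    layers by one, and so produces one extra factor, f itself on layer 0. *)
Lemma swindle_shift f (fN : f \in supp_below) :
  (swindle fN * shift = shift * f * swindle fN)%g.
Proof.
apply: bperm_eq => x; rewrite !bpermM /=.
have fixf y : ~~ below N y -> f y = y by move/asboolP: fN; apply.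
have [xN|xN] := boolP (below N.+1 x); last first.
  rewrite {2}/swindle_fun /shift_fun (negPf xN) /= fixf.
    by rewrite /swindle_fun !(negPf xN).
  by apply: contra xN => /leqW.
have bx := below_base xN.
have bfx : below N (f (translate (- layer x) x)) by rewrite below_supp.
rewrite {1}/shift_fun xN {1}/swindle_fun below_translate //= layer_translate.
have -> : translate (- (layer x + 1)) (translate 1 x) = translate (- layer x) x.
  by rewrite -translateD opprD addrNK.
rewrite {1}/swindle_fun xN /=.
(* On a negative layer only the shift acts; on a positive one the shift
   commutes with the infinite product and f is trivial; on layer 0, the left
   side acts by f after the shift to layer 1, the right side by f directly. *)
have [x0|x0|x0] := ltgtP (layer x) 0.
- have -> : (0 < layer x + 1) = false by lia.
  rewrite fixf ?below_layer ?xN /= ?(lt_eqF x0) //.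
  by rewrite /shift_fun xN.
- have -> : 0 < layer x + 1 by lia.
  set y := translate (layer x) _.
  move: bfx; rewrite below_layer => /andP[wN /eqP w0].
  have yN : below N.+1 y by apply: below_translate.
  have -> : f y = y.
    by rewrite fixf // below_layer yN layer_translate w0 add0r gt_eqF.
  by rewrite /shift_fun yN addrC translateD.
- rewrite x0 oppr0 translate0 in bfx *; rewrite /shift_fun.
  by move: bfx; rewrite below_layer => /andP[-> _].
Qed.
End Level.

Lemma shift_neq1 : shift 0 <> 1%g.
Proof.
move=> /(congr1 (fun f : bperm => (f (1%g, 0)).2)).
rewrite /= /shift_fun /below size_poly0 /= add0r scale1r.
by move/eqP; rewrite oner_eq0.
Qed.

Lemma finitely_generated_supp (H : groupClosed bperm) :
  finitely_generated H -> exists N, {subset (H : {pred bperm}) <= supp_below N}.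
Proof.
case=> s [_ sH].
have [N sN] : exists N, {subset s <= supp_below N}.
  elim: s {sH} => [|f s [N sN]]; first by exists 0%N.
  have [M fM] := bfun_bounded f; exists (maxn M N) => g.
  rewrite inE => /predU1P[->|/sN /asboolP gN]; apply/asboolP.
    exact: fixes_above_leq (leq_maxl _ _) fM.
  exact: fixes_above_leq (leq_maxr _ _) gN.
by exists N; apply: (sH (supp_below N)).
Qed.

(** A finite generating set has a common bound N, and the shift of level N
    then serves for all elements of the subgroup at once. *)
Lemma bperm_binate : binate bperm.
Proof.
split; first by exists (shift 0); apply: shift_neq1.
move=> H /finitely_generated_supp[N HN].
pose phi (h : subgroup_type H) : bperm := swindle (HN _ (valP h)).
have phiM : {morph phi : x y / x * y}%g by move=> x y; apply: swindleM.
pose phiL := HB.pack_for {multiplicative subgroup_type H -> bperm} phi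
  (monoid.isMultiplicative.Build (subgroup_type H) bperm phi phiM).
exists phiL, (shift N)^-1%g => h.
rewrite /commutator invgK [phiL h]/(phi h) -(mulgA _ (phi h)) swindle_shift.
by rewrite -!mulgA mulgV mulg1 mulKg.
Qed.

(** * The embedding on the copy at the zero polynomial *)

Definition embed_fun (g : G) x : fibre :=
  if x.2 == 0 then ((g * x.1)%g, x.2) else x.

Lemma embed_funM g h x : embed_fun (g * h)%g x = embed_fun g (embed_fun h x).
Proof. by rewrite /embed_fun; case: ifP => /= [->|->] //; rewrite mulgA. Qed.

Lemma embed_fun1 x : embed_fun 1%g x = x.
Proof. by rewrite /embed_fun mul1g -surjective_pairing if_same. Qed.

Definition embed (g : G) : bperm.
Proof.
apply: (@BPerm (embed_fun g) (embed_fun g^-1%g)).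
- by move=> x; rewrite -embed_funM mulVg embed_fun1.
- by move=> x; rewrite -embed_funM mulgV embed_fun1.
- move=> h x; rewrite /embed_fun /=; case: ifP => //= _.
  by rewrite /ract /= mulgA.
by exists 0%N => x; rewrite /below leqn0 size_poly_eq0 /embed_fun => /negPf->.
Defined.

Fact embed_monoid_morphism : monoid.monoid_morphism embed.
Proof.
split=> [|g h]; apply: bperm_eq; first exact: embed_fun1.
exact: embed_funM.
Qed.
HB.instance Definition _ := isUMagmaMorphism.Build
  G bperm embed embed_monoid_morphism.

Lemma embed_inj : injective embed.
Proof.
move=> g h /(congr1 (fun f : bperm => (f (1%g, 0)).1)).
by rewrite /= /embed_fun eqxx /= !mulg1.
Qed.

(** Compare both sides of b g = h b at the point (1, 0).  If b keeps the copy
    at 0 and acts on it by c, then c g = h c.  If it moves that copy, h acts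
    trivially on the image, and so g = 1, whence h = 1. *)
Lemma embed_conj g h (b : bperm) :
  (embed g = embed h ^ b)%g -> exists c, (g = h ^ c)%g.
Proof.
move=> /(congr1 (fun z => (b * z)%g)); rewrite conjgE mulgA mulgV mul1g => gh.
have [g1|/eqP g1] := eqVneq g 1%g.
  exists 1%g; rewrite g1 conjg1; apply/esym/embed_inj.
  by apply: (mulIg b); rewrite -gh g1 gmulf1 mulg1 mul1g.
move: gh => /(congr1 (fun f : bperm => f (1%g, 0))); rewrite !bpermM /=.
rewrite {1}/embed_fun eqxx /= mulg1.
have -> : (g, 0) = ract g (1%g, 0) by rewrite /ract /= mul1g.
rewrite bfun_ract /ract /embed_fun.
case: (b (1%g, 0)) => c p /=; case: eqP => _ [] E.
  by exists c; rewrite conjgE -E mulKg.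
by case: g1; apply: (mulgI c); rewrite E mulg1.
Qed.
End BinateHull.

Theorem corollary4p4 :
  (forall G : groupType, bass_conjecture G) <->
  (forall G : groupType, binate G -> bass_conjecture G).
Proof.
split=> [bass G _|bass G]; first exact: bass.
exact: (bass_conjecture_pullback (@embed_conj G) (bass _ (bperm_binate G))).
Qed.
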